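(* Let $A \in \mathbb{R}^{n \times n}$ be a symmetric positive definite matrix and let $\Delta t > 0$. Let $(x_i)_{i \ge 0}$ be the Euler-Maruyama approximation of the Ornstein-Uhlenbeck process $dX_t = -A X_t\,dt + \sqrt{2}\,dW_t$, i.e. $$x_{i+1} = (I - \Delta t A)x_i + \sqrt{2\Delta t}\, Z_i, \qquad i \ge 0,$$ where $Z_0, Z_1, \ldots$ are independent $\mathcal{N}(0, I_n)$ random vectors and $x_0$ is an $\mathbb{R}^n$-valued random vector with finite second moments, independent of $(Z_i)_{i\ge0}$. Then the matrices $\Sigma_i = \mathbb{E}[x_i x_i^\top]$ satisfy, for all $i \ge 0$, $$\Sigma_{i+1} = (I - \Delta t A)\,\Sigma_i\,(I - \Delta t A) + 2\Delta t\, I.$$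
   Context: $I = I_n$ is the $n \times n$ identity matrix. The matrix $\Sigma_i$ (called the covariance, or autocorrelation, matrix) is by definition the uncentered second-moment matrix $\mathbb{E}[x_i x_i^\top]$. *)

(* Defs.v *)
From HB Require Import structures.
From mathcomp Require Import all_boot all_order all_algebra finmap.
From mathcomp Require Import all_classical all_reals all_analysis.

Set Implicit Arguments.
Unset Strict Implicit.
Unset Printing Implicit Defensive.

Import Order.TTheory GRing.Theory Num.Theory.
Import numFieldNormedType.Exports.

Local Open Scope classical_set_scope.
Local Open Scope ring_scope.

Definition mx_display : measure_display -> measure_display.
Proof. exact. Qed.

(* Matrices carry the product sigma-algebra, generated by the entries; for
   'cV[R]_n this is the Borel sigma-algebra of R^n.  Like the library's instance
   on n.-tuple T. *)
Section measurable_matrix.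
Context {d} {T : measurableType d}.
Variables m n : nat.

Definition mx_measurable : set_system 'M[T]_(m, n) :=
  <<s \bigcup_(ij in [set: 'I_m * 'I_n])
        preimage_set_system [set: 'M[T]_(m, n)] (fun M => M ij.1 ij.2) measurable >>.

Let mx_measurable0 : mx_measurable set0.
Proof. exact: sigma_algebra0. Qed.

Let mx_measurableC A : mx_measurable A -> mx_measurable (~` A).
Proof. exact: sigma_algebraC. Qed.

Let mx_measurable_bigcup (F : (set 'M[T]_(m, n))^nat) :
  (forall i, mx_measurable (F i)) -> mx_measurable (\bigcup_i F i).
Proof. exact: sigma_algebra_bigcup. Qed.

HB.instance Definition _ := @isMeasurable.Build (mx_display d) 'M[T]_(m, n)
  mx_measurable mx_measurable0 mx_measurableC mx_measurable_bigcup.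

End measurable_matrix.

Definition sigma_RV d d' (T : measurableType d) (T' : measurableType d')
    (X : T -> T') : set_system T :=
  preimage_set_system [set: T] X measurable.

Definition sigma_RVs d d' (T : measurableType d) (T' : measurableType d')
    (I : Type) (X : I -> T -> T') : set_system T :=
  <<s \bigcup_(i in [set: I]) sigma_RV (X i) >>.

Section independence.
Context d (T : measurableType d) (R : realType) (P : probability T R).
Local Open Scope ereal_scope.

Definition independent_classes (F G : set_system T) :=
  forall A B, F A -> G B -> P (A `&` B) = P A * P B.

Definition mutually_independent d' (T' : measurableType d') (I : choiceType)
    (X : I -> T -> T') :=
  forall (J : {fset I}) (B : I -> set T'), (forall i, measurable (B i)) ->
    P (\bigcap_(i in [set` J]) X i @^-1` B i) =
    \prod_(i <- J) P (X i @^-1` B i).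

End independence.

Section random_vectors.
Context d (T : measurableType d) (R : realType) (P : probability T R).

(* The law N(0, I_n): independent coordinates, each with law N(0, 1). *)
Definition std_normal_vector n (Z : T -> 'cV[R]_n) :=
  mutually_independent P (fun (j : 'I_n) w => Z w j 0) /\
  forall (j : 'I_n) (B : set R), measurable B ->
    P ((fun w => Z w j 0) @^-1` B) = normal_prob 0 1 B.

Definition finite_second_moments n (X : T -> 'cV[R]_n) :=
  forall j : 'I_n, (fun w => X w j 0) \in Lfun P 2%:E.

(* Entrywise expectation; meaningful when the entries are integrable, since
   fine sends infinite values to 0. *)
Definition expectation_mx m n (M : T -> 'M[R]_(m, n)) : 'M[R]_(m, n) :=
  \matrix_(i, j) fine 'E_P[fun w => M w i j].

(* Uncentered: the autocorrelation matrix E[X X^T]. *)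
Definition covariance_mx n (X : T -> 'cV[R]_n) : 'M[R]_n :=
  expectation_mx (fun w => X w *m (X w)^T).

End random_vectors.

Definition posdefmx (R : realType) n (A : 'M[R]_n) :=
  forall v : 'cV[R]_n, v != 0 -> 0 < (v^T *m A *m v) 0 0.

(* Main.v *)
From HB Require Import structures.
Require Import Defs.
From mathcomp Require Import all_boot all_order all_algebra finmap.
From mathcomp Require Import all_classical all_reals all_analysis.
From mathcomp Require Import measurable_realfun ring lra.

Set Implicit Arguments.
Unset Strict Implicit.
Unset Printing Implicit Defensive.

Import Order.TTheory GRing.Theory Num.Theory.
Import numFieldNormedType.Exports.

Local Open Scope classical_set_scope.
Local Open Scope ring_scope.

(** Write [M := I - dt A], which is symmetric, and [s := sqrt (2 dt)], so that
    [x_{i+1} = M x_i + s Z_i].  The cross second-moment matrix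
    [C(X, Y) := E[X Y^T]] is bilinear on square-integrable random vectors, hence
    [C(x_{i+1}, x_{i+1}) = M C(x_i, x_i) M + s (M C(x_i, Z_i))
      + s (M C(x_i, Z_i))^T + s^2 C(Z_i, Z_i)],
    and the claim reduces to [C(Z_i, Z_i) = I] and [C(x_i, Z_i) = 0].

    Since only second moments matter, the second equation follows from pairwise
    independence alone: one proves [C(x_i, Z_j) = 0] for all [i <= j] by
    induction on [i].  For [i = 0] it comes from the independence of [x_0] and
    [Z_j]; for the step, the recursion gives
    [C(x_{i+1}, Z_j) = M C(x_i, Z_j) + s C(Z_i, Z_j)] with [i < j], and the last
    term vanishes by the independence of [Z_i] and [Z_j].

    Two facts of probability carry this.  First, independent square-integrable
    real random variables satisfy [E[XY] = E[X] E[Y]]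
    ([expectation_mul_independent]): their joint law is a product measure, and
    Fubini's theorem applies.  Second, N(0, 1) has mean 0, by symmetry
    ([integral_id_std_normal]), and second moment 1
    ([integral_sqr_std_normal]), because [(x phi(x))' = (1 - x^2) phi(x)]
    and [x phi(x)] vanishes at 0 and at infinity. *)

(** * Square-integrable functions *)

Section square_integrable.
Context d (T : measurableType d) (R : realType).
Variable mu : {measure set T -> \bar R}.

Lemma Lfun2_sqr_lty (f : T -> R) : measurable_fun setT f ->
  (\int[mu]_x (f x ^+ 2)%:E < +oo)%E -> f \in Lfun mu 2%:E.
Proof.
move=> mf foo; rewrite inE; apply/andP; split; rewrite inE//=.
rewrite /finite_norm unlock /Lnorm poweR_lty//.
under eq_integral do rewrite abse_EFin poweR_EFin powR_mulrn// real_normK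
  ?num_real//.
by [].
Qed.

End square_integrable.

(** * Moments of the standard normal law *)

Section standard_normal.
Variable R : realType.
Local Notation mu := (@lebesgue_measure R).
Local Notation phi := (@normal_pdf R 0 1).

Lemma std_normal_pdfE x : phi x = normal_peak 1 * expR (- (x ^+ 2) / 2).
Proof.
by rewrite normal_pdfE ?oner_eq0// /normal_fun subr0 expr1n.
Qed.

Lemma std_normal_pdfN x : phi (- x) = phi x.
Proof. by rewrite !std_normal_pdfE sqrrN. Qed.

(** Both the density and Lebesgue measure are invariant under [x |-> - x]. *)
Lemma std_normal_prob_preimage_opp (B : set R) : measurable B ->
  normal_prob 0 1 (-%R @^-1` B) = normal_prob 0 1 B :> \bar R.
Proof.
move=> mB; rewrite /normal_prob.
transitivity (\int[pushforward mu (-%R : R -> measurableTypeR R)]_(x in B)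
    (phi x)%:E)%E.
  rewrite ge0_integral_pushforward//=.
  - by apply: eq_integral => x _; rewrite std_normal_pdfN.
  - by apply/measurable_EFinP/measurable_funTS; exact: measurable_normal_pdf.
  - by move=> x _; rewrite lee_fin normal_pdf_ge0.
by apply: eq_measure_integral => A mA _; exact: lebesgue_measureN.
Qed.

(** The Radon-Nikodym derivative of the law with respect to Lebesgue measure is
    almost everywhere the density.  Nonnegative functions suffice, and they
    avoid any prior integrability, which is what this lemma helps to prove. *)
Lemma ge0_integral_std_normal (f : R -> \bar R) :
  measurable_fun setT f -> (forall x, 0 <= f x)%E ->
  (\int[normal_prob 0 1]_x f x = \int[mu]_x (f x * (phi x)%:E))%E.
Proof.
move=> mf f0.
have dom : normal_prob 0 1 `<< mu := normal_prob_dominates 0 1.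
rewrite -(Radon_Nikodym_SigmaFinite.change_of_variables dom)//=.
apply: ae_eq_integral => //.
- apply: emeasurable_funM => //; apply: (measurable_int mu).
  exact: Radon_Nikodym_SigmaFinite.f_integrable.
- apply: emeasurable_funM => //; apply/measurable_EFinP.
  exact: measurable_normal_pdf.
- apply: ae_eqe_mul2l; apply: integral_ae_eq => //=.
  + exact: Radon_Nikodym_SigmaFinite.f_integrable.
  + by apply/measurable_EFinP; exact: measurable_normal_pdf.
  + by move=> E _ mE; rewrite -Radon_Nikodym_SigmaFinite.f_integral.
Qed.

Lemma is_derive_std_normal_pdf (x : R) : is_derive x 1 phi (- (x * phi x)).
Proof.
rewrite (_ : phi = fun y => normal_peak 1 * expR (- (y ^+ 2) / 2)); last first.
  by apply/funext => y; rewrite std_normal_pdfE.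
apply: is_derive_eq.
rewrite /GRing.scale/=.
by field.
Qed.

Lemma is_derive_id_std_normal_pdf (x : R) :
  is_derive x 1 (fun y => y * phi y) ((1 - x ^+ 2) * phi x).
Proof.
have dphi := is_derive_std_normal_pdf x.
apply: is_derive_eq.
rewrite /GRing.scale/=; ring.
Qed.

Lemma continuous_std_normal_pdf : continuous phi.
Proof. by apply: continuous_normal_pdf; exact: oner_neq0. Qed.

Lemma continuous_poly_std_normal_pdf (p : {poly R}) :
  continuous (fun x => p.[x] * phi x).
Proof.
move=> x; apply: cvgM; last exact: continuous_std_normal_pdf.
exact: continuous_horner.
Qed.

(** From [1 + x^2/2 <= exp (x^2/2)], the product is squeezed between 0 and a
    multiple of [1/x]. *)
Lemma cvg_id_std_normal_pdf : (fun x => x * phi x) x @[x --> +oo] --> (0 : R).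
Proof.
have cvg0 : (normal_peak 1 * 2) * x^-1 @[x --> +oo] --> (0 : R).
  rewrite -(mulr0 (normal_peak 1 * 2)); apply: cvgM; first exact: cvg_cst.
  by apply/gtr0_cvgV0; [exact: nbhs_pinfty_gt|exact: cvg_id].
apply: (squeeze_cvgr _ (cvg_cst 0) cvg0).
near=> x; have x0 : 0 < x by near: x; exact: nbhs_pinfty_gt.
rewrite mulr_ge0 ?(ltW x0) ?normal_pdf_ge0//=.
rewrite std_normal_pdfE mulrCA -mulrA ler_wpM2l ?normal_peak_ge0//.
rewrite mulNr expRN ler_pdivrMr ?expR_gt0//.
apply: (@le_trans _ _ (2 / x * (1 + x ^+ 2 / 2))); last first.
  by rewrite ler_wpM2l ?expR_ge1Dx// divr_ge0// ltW.
rewrite [leRHS](_ : _ = 2 / x + x) ?lerDr ?divr_ge0 ?ltW//.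
by field; rewrite gt_eqF.
Unshelve. all: by end_near. Qed.


Lemma measurable_poly_std_normal_pdf D (p : {poly R}) :
  measurable_fun D (fun x => (p.[x] * phi x)%:E).
Proof.
apply/measurable_EFinP; apply: measurable_funTS.
by apply: continuous_measurable_fun; exact: continuous_poly_std_normal_pdf.
Qed.

(** [(1 - x^2) phi(x)] is the derivative of [x phi(x)] and changes sign at 1.
    Cutting there leaves two integrands of constant sign, so that the
    fundamental theorem of calculus on the half-line [[1, +oo[] can be used for
    nonnegative integrands, without knowing that [x^2 phi(x)] is integrable.
    The values on both sides of 1 are the same, since [x phi(x)] goes from 0
    to [phi 1] and back to 0. *)
Lemma integral_std_normal_pdf_01 :
  (\int[mu]_(x in `[0%R, 1%R]) ((1 - x ^+ 2) * phi x)%:E = (phi 1)%:E)%E.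
Proof.
have cont : continuous (fun x : R => (1 - x ^+ 2) * phi x).
  rewrite (_ : (fun x => _) = fun x => (1 - 'X^2).[x] * phi x).
    exact: continuous_poly_std_normal_pdf.
  by apply/funext => x; rewrite !hornerE.
rewrite (@continuous_FTC2 _ _ (fun x => x * phi x))//.
- by rewrite mul1r mul0r sube0.
- exact: continuous_subspaceT.
- have dF x := is_derive_id_std_normal_pdf x.
  have cF : continuous (fun x : R => x * phi x).
    move=> x; apply/differentiable_continuous/derivable1_diffP.
    exact: (@ex_derive _ _ _ _ _ _ _ (dF x)).
  split => /=.
  + by move=> x _; exact: (@ex_derive _ _ _ _ _ _ _ (dF x)).
  + by apply: cvg_at_right_filter; exact: cF.
  + by apply: cvg_at_left_filter; exact: cF.
- move=> x _; rewrite derive1E.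
  by have [_ ->] := is_derive_id_std_normal_pdf x.
Qed.

Lemma integral_std_normal_pdf_1y :
  (\int[mu]_(x in `[1%R, +oo[) ((x ^+ 2 - 1) * phi x)%:E = (phi 1)%:E)%E.
Proof.
have cont : continuous (fun x : R => (x ^+ 2 - 1) * phi x).
  rewrite (_ : (fun x => _) = fun x => ('X^2 - 1).[x] * phi x).
    exact: continuous_poly_std_normal_pdf.
  by apply/funext => x; rewrite !hornerE.
have dF (x : R) :
    is_derive x 1 (fun y : R => - (y * phi y)) ((x ^+ 2 - 1) * phi x).
  have d := is_derive_id_std_normal_pdf x.
  by apply: is_derive_eq; ring.
rewrite (@ge0_continuous_FTC2y _ _ (fun x => - (x * phi x)) _ 0)//.
- by rewrite mul1r EFinN oppeK add0e.
- by move=> x x1; rewrite mulr_ge0 ?normal_pdf_ge0// subr_ge0 exprn_ege1.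
- exact: continuous_subspaceT.
- suff : (fun x : R => - (x * phi x)) x @[x --> +oo] --> - (0 : R).
    by rewrite oppr0.
  by apply: cvgN; exact: cvg_id_std_normal_pdf.
- have cF : continuous (fun x : R => - (x * phi x)).
    move=> x; apply/differentiable_continuous/derivable1_diffP.
    exact: (@ex_derive _ _ _ _ _ _ _ (dF x)).
  by apply: cvg_at_right_filter; exact: cF.
- by move=> x _; rewrite derive1E; have [_ ->] := dF x.
Qed.

(** Passing from [phi] to [x^2 phi] removes [phi 1] from the integral over
    [[0, 1]] and adds it back over [[1, +oo[]. *)
Lemma integral0y_sqr_std_normal_pdf :
  (\int[mu]_(x in `[0%R, +oo[) (x ^+ 2 * phi x)%:E =
   \int[mu]_(x in `[0%R, +oo[) (phi x)%:E)%E.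
Proof.
have split_at1 (p : {poly R}) : (forall x, 0 <= p.[x]) ->
    (\int[mu]_(x in `[0%R, +oo[) (p.[x] * phi x)%:E =
     \int[mu]_(x in `[0%R, 1%R]) (p.[x] * phi x)%:E +
     \int[mu]_(x in `[1%R, +oo[) (p.[x] * phi x)%:E)%E.
  move=> p0; rewrite -(@integral_itv_obnd_cbnd _ 1); last first.
    exact: measurable_poly_std_normal_pdf.
  rewrite -ge0_integral_setU//=.
  - by rewrite -itv_bndbnd_setU ?bnd_simp.
  - exact: measurable_poly_std_normal_pdf.
  - by move=> x _; rewrite lee_fin mulr_ge0 ?p0 ?normal_pdf_ge0.
  - apply/disj_setPLR => x /=; rewrite !in_itv/= => /andP[_ x1].
    by rewrite ltNge x1.
have eqX2 x : ('X^2 : {poly R}).[x] = x ^+ 2 by rewrite !hornerE.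
have eq1 x : (1 : {poly R}).[x] * phi x = phi x by rewrite !hornerE.
under eq_integral do rewrite -eqX2.
under [RHS]eq_integral do rewrite -eq1.
rewrite !split_at1; [|by move=> x; rewrite hornerE..|]; last first.
  by move=> x; rewrite eqX2 sqr_ge0.
(* On each side of 1 only sums of nonnegative integrands are used, so that
   additivity holds in the extended reals. *)
have <- : (\int[mu]_(x in `[0%R, 1%R]) ((1 - x ^+ 2) * phi x)%:E +
    \int[mu]_(x in `[0%R, 1%R]) (('X^2 : {poly R}).[x] * phi x)%:E =
    \int[mu]_(x in `[0%R, 1%R]) ((1 : {poly R}).[x] * phi x)%:E)%E.
  rewrite -ge0_integralD//=; last 4 first.
  - move=> x; rewrite in_itv/= => /andP[x0 x1].
    by rewrite lee_fin mulr_ge0 ?normal_pdf_ge0// subr_ge0 exprn_ile1.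
  - have := @measurable_poly_std_normal_pdf `[0, 1] (1 - 'X^2).
    by apply: eq_measurable_fun => x _; rewrite !hornerE.
  - by move=> x _; rewrite lee_fin mulr_ge0 ?normal_pdf_ge0// eqX2 sqr_ge0.
  - exact: measurable_poly_std_normal_pdf.
  by apply: eq_integral => x _; rewrite -EFinD eqX2 eq1 -mulrDl subrK mul1r.
have -> : (\int[mu]_(x in `[1%R, +oo[) (('X^2 : {poly R}).[x] * phi x)%:E =
    \int[mu]_(x in `[1%R, +oo[) ((x ^+ 2 - 1) * phi x)%:E +
    \int[mu]_(x in `[1%R, +oo[) ((1 : {poly R}).[x] * phi x)%:E)%E.
  rewrite -ge0_integralD//=; last 4 first.
  - move=> x; rewrite in_itv/= andbT => x1.
    by rewrite lee_fin mulr_ge0 ?normal_pdf_ge0// subr_ge0 exprn_ege1.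
  - have := @measurable_poly_std_normal_pdf `[1, +oo[ ('X^2 - 1).
    by apply: eq_measurable_fun => x _; rewrite !hornerE.
  - by move=> x _; rewrite lee_fin eq1 normal_pdf_ge0.
  - exact: measurable_poly_std_normal_pdf.
  by apply: eq_integral => x _; rewrite -EFinD eqX2 eq1 mulrBl mul1r subrK.
by rewrite integral_std_normal_pdf_01 integral_std_normal_pdf_1y addeCA addeA.
Qed.

Lemma integral_sqr_std_normal :
  (\int[normal_prob 0 1]_x (x ^+ 2)%:E = (1 : \bar R))%E.
Proof.
have cX2 : continuous (fun x : R => x ^+ 2 * phi x).
  rewrite (_ : (fun x => _) = fun x => ('X^2).[x] * phi x).
    exact: continuous_poly_std_normal_pdf.
  by apply/funext => x; rewrite !hornerE.
rewrite ge0_integral_std_normal//; last 2 first.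
- by apply/measurable_EFinP; exact: measurable_funX.
- by move=> x; rewrite lee_fin sqr_ge0.
under eq_integral do rewrite -EFinM.
rewrite -[RHS](integral_normal_pdf 0 (1 : R)).
rewrite !ge0_symfun_integralT//; last 5 first.
- by move=> x; exact: normal_pdf_ge0.
- exact: continuous_std_normal_pdf.
- by move=> x /=; rewrite std_normal_pdfN.
- by move=> x; rewrite mulr_ge0 ?sqr_ge0 ?normal_pdf_ge0.
- by move=> x /=; rewrite std_normal_pdfN sqrrN.
by rewrite -set_itvcy integral0y_sqr_std_normal_pdf.
Qed.

Lemma Lfun2_id_std_normal : (id : R -> R) \in Lfun (normal_prob 0 1) 2%:E.
Proof. by apply: Lfun2_sqr_lty => //; rewrite integral_sqr_std_normal ltry. Qed.

(** The law is its own image under [x |-> - x], so the mean, which is finite,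
    equals its opposite. *)
Lemma integral_id_std_normal :
  (\int[normal_prob 0 1]_x x%:E = (0 : \bar R))%E.
Proof.
have intid : (normal_prob (0 : R) 1).-integrable setT (EFin \o id).
  apply/Lfun1_integrable; apply: Lfun_subset12 Lfun2_id_std_normal.
  exact: fin_num_measure.
have eqN : (\int[normal_prob 0 1]_x x%:E =
            - \int[normal_prob 0 1]_x x%:E :> \bar R)%E.
  rewrite -[RHS]integralN; last exact: integrable_add_def.
  transitivity (\int[pushforward (normal_prob 0 1)
      (-%R : R -> measurableTypeR R)]_x x%:E)%E.
    apply: eq_measure_integral => A mA _; apply/esym.
    exact: std_normal_prob_preimage_opp.
  rewrite integral_pushforward//=.
  exact: (integrableN intid).
have := integrable_fin_num measurableT intid.
move: eqN => /=; case: (integral _ _ _) => //= r [] rN _.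
by congr EFin; lra.
Qed.

End standard_normal.

(** * Independence and products of random variables *)

Section independence.
Context d (T : measurableType d) (R : realType) (P : probability T R).

Lemma independent_classesS (F F' G G' : set_system T) :
  F `<=` F' -> G `<=` G' ->
  independent_classes P F' G' -> independent_classes P F G.
Proof. by move=> FF' GG' FG A B /FF' ? /GG'; exact: FG. Qed.

(** The product rule of the whole family, read on the two-element subfamily. *)
Lemma mutually_independent_pair d' (T' : measurableType d') (I : choiceType)
    (X : I -> T -> T') (i j : I) : i != j -> mutually_independent P X ->
  independent_classes P (sigma_RV (X i)) (sigma_RV (X j)).
Proof.
move=> ij indep _ _ [A mA <-] [B mB <-]; rewrite !setTI.
have := indep [fset i; j]%fset (fun k => if k == i then A else B).
rewrite big_fsetU1 ?inE//= big_seq_fset1 eqxx [j == i]eq_sym (negbTE ij).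
move=> <-; last by move=> k; case: ifP.
congr (P _); apply/seteqP; split => [w [Aw Bw] k /=|w h].
  rewrite !inE => /orP[/eqP->|/eqP->]; first by rewrite eqxx.
  by rewrite eq_sym (negbTE ij).
split.
  by have /= := h i; rewrite !inE eqxx; exact.
by have /= := h j; rewrite !inE eqxx orbT eq_sym (negbTE ij); exact.
Qed.

(** Independence says that the law of [(X, Y)] and the product of the two laws
    agree on rectangles, hence everywhere; Fubini's theorem then factors the
    integral of [x * y].  Its integrability comes from that of [X * Y], by
    Hoelder's inequality. *)
Lemma expectation_mul_independent (X Y : T -> R) :
  X \in Lfun P 2%:E -> Y \in Lfun P 2%:E ->
  independent_classes P (sigma_RV X) (sigma_RV Y) ->
  ('E_P[X \* Y] = 'E_P[X] * 'E_P[Y])%E.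
Proof.
move=> X2 Y2 XY.
have mX : measurable_fun setT X := set_mem (sub_Lfun_mfun X2).
have mY : measurable_fun setT Y := set_mem (sub_Lfun_mfun Y2).
have L1 (U : T -> R) : U \in Lfun P 2%:E -> U \in Lfun P 1.
  by apply: Lfun_subset12; exact: fin_num_measure.
have /Lfun1_integrable iX := L1 _ X2.
have /Lfun1_integrable iY := L1 _ Y2.
have /Lfun1_integrable iXY := Lfun2_mul_Lfun1 X2 Y2.
pose X' : {RV P >-> R} := HB.pack X (isMeasurableFun.Build _ _ _ _ _ mX).
pose Y' : {RV P >-> R} := HB.pack Y (isMeasurableFun.Build _ _ _ _ _ mY).
have mXY : measurable_fun setT (fun w => (X w, Y w)).
  exact: measurable_fun_pair.
pose XY' : {RV P >-> (R * R)%type} :=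
  HB.pack (fun w => (X w, Y w)) (isMeasurableFun.Build _ _ _ _ _ mXY).
pose h (z : R * R) : \bar R := (z.1 * z.2)%:E.
have mh : measurable_fun setT h.
  by apply/measurable_EFinP; exact: measurable_funM.
have joint A : measurable A ->
    (distribution P X' \x distribution P Y')%E A = distribution P XY' A.
  move=> mA; apply: product_measure_unique => //= B C mB mC.
  rewrite /distribution /pushforward /=.
  rewrite -XY; [|by exists B; rewrite ?setTI|by exists C; rewrite ?setTI].
  by congr (P _).
have ih : (distribution P X' \x distribution P Y')%E.-integrable setT h.
  apply/integrableP; split => //.
  rewrite (eq_measure_integral (distribution P XY')) => [|A mA _]; last first.
    exact: joint.
  have : (distribution P XY').-integrable setT h.
    exact: (integrable_pushforward (phi := XY')).
  by move/integrableP => [].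
rewrite !unlock.
transitivity (\int[distribution P XY']_z h z)%E.
  by rewrite integral_distribution.
transitivity (\int[distribution P X' \x distribution P Y']_z h z)%E.
  by apply: eq_measure_integral => A mA _; apply/esym; exact: joint.
rewrite -integral12_prod_meas1// /fubini_F /h/=.
have iX' : (distribution P X').-integrable setT EFin.
  exact: (integrable_pushforward (phi := X')).
have iY' : (distribution P Y').-integrable setT EFin.
  exact: (integrable_pushforward (phi := Y')).
have /fineK Yfin := integrable_fin_num measurableT iY'.
transitivity (\int[distribution P X']_x
    (x%:E * (fine (\int[distribution P Y']_y y%:E))%:E))%E.
  apply: eq_integral => x _; rewrite Yfin -integralZl//.
rewrite integralZr// Yfin.
by congr (_ * _)%E; rewrite integral_distribution.
Qed.

End independence.

(** * Second moments of random vectors *)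

Section second_moments.
Context d (T : measurableType d) (R : realType) (P : probability T R).

Lemma fine_expectation_sum (I : finType) (f : I -> T -> R) :
  (forall i, f i \in Lfun P 1) ->
  fine 'E_P[fun w => \sum_i f i w] = \sum_i fine 'E_P[f i].
Proof.
move=> f1.
have -> : (fun w => \sum_i f i w) = \sum_(g <- [seq f i | i <- index_enum I]) g.
  by apply/funext => w; rewrite big_map fct_sumE.
rewrite expectation_sum => [|g /mapP[i _ ->]//].
by rewrite big_map -EFin_sum_fine// => i _; exact: expectation_fin_num.
Qed.

(** The polarization of [covariance_mx], also uncentered: [covariance_mx P X] is
    [cross_covariance_mx X X] by conversion. *)
Definition cross_covariance_mx m n (X : T -> 'cV[R]_m) (Y : T -> 'cV[R]_n) :=
  expectation_mx P (fun w => X w *m (Y w)^T).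

Lemma cross_covariance_mxE m n (X : T -> 'cV[R]_m) (Y : T -> 'cV[R]_n) i j :
  cross_covariance_mx X Y i j =
  fine 'E_P[(fun w => X w i 0) \* (fun w => Y w j 0)].
Proof.
rewrite mxE; congr (fine 'E_P[ _ ]); apply/funext => w.
by rewrite mxE big_ord1 mxE.
Qed.

Lemma cross_covariance_mx_tr m n (X : T -> 'cV[R]_m) (Y : T -> 'cV[R]_n) :
  (cross_covariance_mx X Y)^T = cross_covariance_mx Y X.
Proof.
apply/matrixP => i j; rewrite mxE !cross_covariance_mxE.
by congr (fine 'E_P[ _ ]); apply/funext => w; exact: mulrC.
Qed.

Lemma finite_second_momentsD n (X Y : T -> 'cV[R]_n) :
  finite_second_moments P X -> finite_second_moments P Y ->
  finite_second_moments P (fun w => X w + Y w).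
Proof.
move=> X2 Y2 j.
rewrite (_ : (fun w => _) = (fun w => X w j 0) + (fun w => Y w j 0)).
  by rewrite rpredD ?lee1n.
by apply/funext => w; rewrite mxE.
Qed.

Lemma finite_second_moments_mulmx m n (M : 'M[R]_(m, n)) (X : T -> 'cV[R]_n) :
  finite_second_moments P X -> finite_second_moments P (fun w => M *m X w).
Proof.
move=> X2 j.
rewrite (_ : (fun w => _) = \sum_k M j k *: (fun w => X w k 0)).
  by rewrite rpred_sum ?lee1n// => le12 k _; rewrite rpredZ.
by apply/funext => w; rewrite mxE fct_sumE.
Qed.

Lemma cross_covariance_mxDl m n (X Y : T -> 'cV[R]_m) (V : T -> 'cV[R]_n) :
  finite_second_moments P X -> finite_second_moments P Y ->
  finite_second_moments P V ->
  cross_covariance_mx (fun w => X w + Y w) V =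
  cross_covariance_mx X V + cross_covariance_mx Y V.
Proof.
move=> X2 Y2 V2; apply/matrixP => i j; rewrite [RHS]mxE !cross_covariance_mxE.
have XV := Lfun2_mul_Lfun1 (X2 i) (V2 j).
have YV := Lfun2_mul_Lfun1 (Y2 i) (V2 j).
rewrite -fineD ?expectation_fin_num// -expectationD//.
by congr (fine 'E_P[ _ ]); apply/funext => w /=; rewrite mxE mulrDl.
Qed.

Lemma cross_covariance_mx_mulmxl m n p (M : 'M[R]_(m, n)) (X : T -> 'cV[R]_n)
    (V : T -> 'cV[R]_p) :
  finite_second_moments P X -> finite_second_moments P V ->
  cross_covariance_mx (fun w => M *m X w) V = M *m cross_covariance_mx X V.
Proof.
move=> X2 V2; apply/matrixP => i j; rewrite [RHS]mxE cross_covariance_mxE.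
have XV k : (fun w => X w k 0) \* (fun w => V w j 0) \in Lfun P 1.
  exact: Lfun2_mul_Lfun1 (X2 k) (V2 j).
pose f k := M i k \o* ((fun w => X w k 0) \* (fun w => V w j 0)).
transitivity (fine 'E_P[fun w => \sum_k f k w]).
  congr (fine 'E_P[ _ ]); apply/funext => w /=; rewrite mxE mulr_suml.
  by apply: eq_bigr => k _; rewrite /f/= [RHS]mulrC mulrA.
rewrite fine_expectation_sum => [|k]; last exact: Lfun_scale.
apply: eq_bigr => k _; rewrite cross_covariance_mxE expectationZl//.
by rewrite fineM ?expectation_fin_num.
Qed.

(** The product sigma-algebra is generated by the entries. *)
Lemma measurable_mx_entry m n (i : 'I_m) (j : 'I_n) :
  measurable_fun setT (fun M : 'M[R]_(m, n) => M i j).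
Proof.
move=> _ B mB; rewrite setTI; apply: sub_sigma_algebra.
by exists (i, j) => //; exists B; rewrite ?setTI.
Qed.

Lemma sigma_RV_entry n (X : T -> 'cV[R]_n) (i : 'I_n) :
  sigma_RV (fun w => X w i 0) `<=` sigma_RV X.
Proof.
move=> _ [B mB <-]; exists ((fun M : 'cV[R]_n => M i 0) @^-1` B) => //.
by rewrite -[X in measurable X]setTI; exact: measurable_mx_entry.
Qed.

(** Centering one of the two vectors is enough for the product of the means to
    vanish. *)
Lemma cross_covariance_mx_independent m n (X : T -> 'cV[R]_m)
    (Y : T -> 'cV[R]_n) :
  finite_second_moments P X -> finite_second_moments P Y ->
  (forall j, ('E_P[fun w => Y w j 0%R] = 0)%E) ->
  independent_classes P (sigma_RV X) (sigma_RV Y) ->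
  cross_covariance_mx X Y = 0.
Proof.
move=> X2 Y2 Y0 XY; apply/matrixP => i j; rewrite cross_covariance_mxE mxE.
rewrite expectation_mul_independent ?Y0 ?mule0//.
by apply: independent_classesS XY; exact: sigma_RV_entry.
Qed.

(** * Standard normal variables and vectors *)

Section std_normal_RV.
Variable X : T -> R.
Hypothesis mX : measurable_fun setT X.
Hypothesis X_normal :
  forall B, measurable B -> P (X @^-1` B) = normal_prob 0 1 B.

(** [normal_prob] is a measure on [measurableTypeR R], which has the Borel sets
    of [R] but another display; the law of [X] must live on the same type for
    the two to be compared. *)
Let X' : {RV P >-> measurableTypeR R} :=
  HB.pack (X : T -> measurableTypeR R)
    (isMeasurableFun.Build _ _ T (measurableTypeR R) _ mX).

Let ge0_integral_normal_RV (f : R -> \bar R) : measurable_fun setT f ->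
  (forall x, 0 <= f x)%E ->
  (\int[P]_w f (X w) = \int[normal_prob 0 1]_x f x)%E.
Proof.
move=> mf f0; rewrite -(ge0_integral_distribution X')//.
by apply: eq_measure_integral => A mA _; exact: X_normal.
Qed.

Lemma expectation_sqr_std_normal : ('E_P[X \* X] = 1)%E.
Proof.
rewrite unlock (ge0_integral_normal_RV (f := fun x => (x * x)%:E)).
- by under eq_integral do rewrite -expr2; exact: integral_sqr_std_normal.
- by apply/measurable_EFinP; exact: measurable_funM.
- by move=> x; rewrite lee_fin -expr2 sqr_ge0.
Qed.

Lemma Lfun2_std_normal : X \in Lfun P 2%:E.
Proof.
apply: Lfun2_sqr_lty => //.
by have := expectation_sqr_std_normal; rewrite unlock => ->; exact: ltry.
Qed.

Lemma expectation_std_normal : ('E_P[X] = 0)%E.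
Proof.
have /Lfun1_integrable iX : X \in Lfun P 1.
  by apply: Lfun_subset12 Lfun2_std_normal; exact: fin_num_measure.
rewrite unlock -(integral_distribution (X := X') (f := EFin))//.
rewrite -integral_id_std_normal.
by apply: eq_measure_integral => A mA _; exact: X_normal.
Qed.

End std_normal_RV.

Section std_normal_vector.
Variables (n : nat) (Z : {RV P >-> 'cV[R]_n}).
Hypothesis Z_normal : std_normal_vector P Z.

Let mZ j : measurable_fun setT (fun w => Z w j 0).
Proof.
exact: (measurableT_comp (@measurable_mx_entry _ _ j 0)).
Qed.

Lemma finite_second_moments_std_normal : finite_second_moments P Z.
Proof. by move=> j; apply: Lfun2_std_normal (mZ j) _; exact: Z_normal.2. Qed.

Lemma expectation_std_normal_vector j : ('E_P[fun w => Z w j 0%R] = 0)%E.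
Proof. by apply: expectation_std_normal (mZ j) _; exact: Z_normal.2. Qed.

Lemma covariance_mx_std_normal : covariance_mx P Z = 1%:M.
Proof.
apply/matrixP => i j; rewrite [LHS]cross_covariance_mxE mxE.
have [->|ij] := eqVneq i j.
  by rewrite (expectation_sqr_std_normal (mZ j))//; exact: Z_normal.2.
have Z2 := finite_second_moments_std_normal.
rewrite expectation_mul_independent//.
  by rewrite !expectation_std_normal_vector mul0e.
exact: (mutually_independent_pair ij Z_normal.1).
Qed.

End std_normal_vector.

End second_moments.

(** * The covariance recursion *)

Theorem lemma0p1 (R : realType) (d : measure_display) (T : measurableType d)
  (P : probability T R) (n : nat) (A : 'M[R]_n) (dt : R)
  (x Z : nat -> {RV P >-> 'cV[R]_n})
  (A_sym : A \is symmetricmx) (A_posdef : posdefmx A) (dt_gt0 : 0 < dt)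
  (Z_normal : forall i, std_normal_vector P (Z i))
  (Z_indep : mutually_independent P (fun i => Z i : T -> 'cV[R]_n))
  (x0_moments : finite_second_moments P (x 0%N))
  (x0_indep : independent_classes P (sigma_RV (x 0%N))
    (sigma_RVs (fun i => Z i : T -> 'cV[R]_n)))
  (x_rec : forall i w,
    x i.+1 w = (1%:M - dt *: A) *m x i w + Num.sqrt (2 * dt) *: Z i w) :
  (forall i, finite_second_moments P (x i)) /\
  (forall i, covariance_mx P (x i.+1) =
    (1%:M - dt *: A) *m covariance_mx P (x i) *m (1%:M - dt *: A)
    + (2 * dt) *: 1%:M).
Proof.
set M := 1%:M - dt *: A; set s := Num.sqrt (2 * dt).
have Z2 i := finite_second_moments_std_normal (Z_normal i).
have sZ2 i : finite_second_moments P (fun w => s%:M *m Z i w).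
  exact: finite_second_moments_mulmx.
have xE i : x i.+1 = (fun w => M *m x i w + s%:M *m Z i w) :> (T -> 'cV[R]_n).
  by apply/funext => w; rewrite mul_scalar_mx x_rec.
have x2 i : finite_second_moments P (x i).
  elim: i => [//|i IH]; rewrite xE.
  by apply: finite_second_momentsD => //; exact: finite_second_moments_mulmx.
have Mx2 i := finite_second_moments_mulmx M (x2 i).
have cross_step m i (V : T -> 'cV[R]_m) : finite_second_moments P V ->
    cross_covariance_mx P (x i.+1) V =
    M *m cross_covariance_mx P (x i) V + s *: cross_covariance_mx P (Z i) V.
  move=> V2; rewrite xE cross_covariance_mxDl// !cross_covariance_mx_mulmxl//.
  by rewrite mul_scalar_mx.
have Z0 i := expectation_std_normal_vector (Z_normal i).
(* Although only [j = i] is used below, the induction keeps [j] fixed while [i]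
   varies, so it has to cover every [j >= i]. *)
have cross_xZ i j : (i <= j)%N -> cross_covariance_mx P (x i) (Z j) = 0.
  elim: i => [_|i IH ij].
    apply: cross_covariance_mx_independent => //.
    apply: independent_classesS x0_indep => // B ZB.
    by apply: sub_sigma_algebra; exists j.
  rewrite cross_step// IH ?(ltnW ij)// mulmx0 add0r.
  rewrite cross_covariance_mx_independent ?scaler0//.
  by apply: mutually_independent_pair Z_indep; rewrite ltn_eqF.
split=> // i; rewrite -[LHS]/(cross_covariance_mx P (x i.+1) (x i.+1)).
rewrite cross_step// -[cross_covariance_mx P (x i) _]cross_covariance_mx_tr.
rewrite -[cross_covariance_mx P (Z i) _]cross_covariance_mx_tr.
rewrite !cross_step// cross_xZ// mulmx0 add0r.
rewrite -[cross_covariance_mx P (Z i) (x i)]cross_covariance_mx_tr cross_xZ//.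
rewrite [cross_covariance_mx P (Z i) (Z i)]covariance_mx_std_normal//.
rewrite trmx0 scaler0 addr0 trmx_mul cross_covariance_mx_tr.
have A_tr : A^T = A.
  by move: A_sym; rewrite qualifE /= expr0 scale1r map_mx_id// => /eqP <-.
have -> : M^T = M by rewrite /M linearB/= linearZ/= trmx1 A_tr.
rewrite linearZ/= trmx1 scalerA -expr2 sqr_sqrtr ?mulr_ge0 ?ltW//.
by rewrite mulmxA.
Qed.
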